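(* Let $\mathcal{E}$ be a Euclidean vector space with norm $\|\cdot\|$ and let $C$ be a nonempty closed subset of $\mathcal{E}$. If $C$ is geometrically derivable at each of its points, then every function $$R : \bigcup_{x \in C} \{x\} \times T_C(x) \to C$$ such that $R(x, v) \in P_C(x+v)$ for all $x \in C$ and $v \in T_C(x)$ is a retraction on $C$.
   Context: A Euclidean vector space is a finite-dimensional real inner product space; $\|\cdot\|$ is the norm induced by its inner product. Projection: for $x \in \mathcal{E}$, $P_C(x) := \operatorname{argmin}_{y \in C} \|x-y\|$, which is a nonempty compact subset of $C$. Tangent cone: a vector $v \in \mathcal{E}$ is tangent to $C$ at $x \in C$ if there exist a sequence $(x_i)_{i \in \mathbb{N}}$ in $C$ converging to $x$ and a sequence $(t_i)_{i \in \mathbb{N}}$ in $(0,\infty)$ such that $\left(\frac{x_i-x}{t_i}\right)_{i \in \mathbb{N}}$ converges to $v$. The set of all tangent vectors to $C$ at $x$ is denoted by $T_C(x)$. Geometric derivability: given $x \in C$, a vector $v \in T_C(x)$ is derivable if there exist $\varepsilon \in (0,\infty)$ and $\gamma : [0,\varepsilon] \to C$ such that $\gamma(0) = x$ and $\gamma'(0) = v$ (the derivative at $0$ being the one-sided derivative; no other regularity of $\gamma$ is required). The set $C$ is geometrically derivable at $x \in C$ if every $v \in T_C(x)$ is derivable. Retraction: a retraction on $C$ is a function $R : \bigcup_{x \in C} \{x\} \times T_C(x) \to C$ such that, for all $x \in C$ and $v \in T_C(x)$, $$\lim_{t \to 0^+} \frac{R(x, tv)-(x+tv)}{t} = 0.$$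 *)

(* Defs.v *)
From HB Require Import structures.
From mathcomp Require Import all_boot all_order all_algebra sesquilinear.
From mathcomp Require Import all_classical all_reals all_analysis.
Set Implicit Arguments.
Unset Strict Implicit.
Unset Printing Implicit Defensive.
Import Order.TTheory GRing.Theory Num.Theory.
Import numFieldNormedType.Exports.

Local Open Scope classical_set_scope.
Local Open Scope ring_scope.

(* A Euclidean vector space: a finite-dimensional (vectType) normed space whose
   norm, hence also whose topology, is induced by an inner product.  Over the
   real field R, {dot E for idfun} is the type of symmetric positive definite
   bilinear forms on E. *)
HB.mixin Record isEuclidean (R : realType) E
    & NormedModule R E & Vector R E := {
  inner : {dot E for @idfun R} ;
  norm_inner : forall x : E, `|x| = Num.sqrt (inner x x)
}.

#[short(type="euclideanType")]
HB.structure Definition Euclidean (R : realType) :=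
  {E of NormedModule R E & Vector R E & isEuclidean R E}.

Definition projection (R : realType) (E : euclideanType R) (C : set E) (x : E) :
    set E :=
  [set y | C y /\ forall z, C z -> `|x - y| <= `|x - z|].

Definition tangent_cone (R : realType) (E : euclideanType R) (C : set E)
    (x : E) : set E :=
  [set v | exists (x_ : nat -> E) (t_ : nat -> R),
    [/\ forall i, C (x_ i),
        x_ i @[i --> \oo] --> x,
        forall i, 0 < t_ i
      & (t_ i)^-1 *: (x_ i - x) @[i --> \oo] --> v]].

(* The domain of a function {fun A >-> B} is the whole type, but only its
   values on A, which lie in B, are relevant; the derivative at 0 is one-sided
   and, since 0 < eps, only depends on gamma on [0, eps]. *)
Definition derivable_tangent (R : realType) (E : euclideanType R) (C : set E)
    (x v : E) : Prop :=
  exists eps : R, 0 < eps /\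
  exists gamma : {fun `[0, eps] >-> C},
    gamma 0 = x /\ t^-1 *: (gamma t - gamma 0) @[t --> 0^'+] --> v.

Definition geometrically_derivable (R : realType) (E : euclideanType R)
    (C : set E) (x : E) : Prop :=
  forall v, tangent_cone C x v -> derivable_tangent C x v.

Definition tangent_bundle (R : realType) (E : euclideanType R) (C : set E) :
    set (E * E) :=
  \bigcup_(x in C) ([set x] `*` tangent_cone C x).

(* tangent_cone C x is stable under scaling by t > 0, so the limit only
   involves values of Rt on the tangent bundle. *)
Definition is_retraction (R : realType) (E : euclideanType R) (C : set E)
    (Rt : {fun tangent_bundle C >-> C}) : Prop :=
  forall x v : E, C x -> tangent_cone C x v ->
    t^-1 *: (Rt (x, t *: v) - (x + t *: v)) @[t --> 0^'+] --> (0 : E).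

(* Main.v *)
Require Import Defs.
From mathcomp Require Import all_boot all_order all_algebra.
From mathcomp Require Import all_classical all_reals all_analysis.
Import numFieldNormedType.Exports.
Import Order.TTheory GRing.Theory Num.Theory.

Local Open Scope classical_set_scope.
Local Open Scope ring_scope.

(** If gamma is a curve in C with gamma 0 = x and gamma'(0) = v, then gamma t
    competes with Rt (x, t v) in the projection of x + t v, so the error of Rt
    is at most |gamma t - (x + t v)| = o(t). *)

(** The same sequence [x_] works once the step sizes [t_ i] are divided by [t]. This makes the
    projection hypothesis available at [t *: v]. *)
Lemma tangent_coneZ (R : realType) (E : euclideanType R) (C : set E)
    (x v : E) (t : R) :
  0 < t -> tangent_cone C x v -> tangent_cone C x (t *: v).
Proof.
move=> t0 [x_ [t_ [Cx_ x_x t_0 x_v]]].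
exists x_, (fun i => t^-1 * t_ i); split => //.
- by move=> i; rewrite mulr_gt0// invr_gt0.
- rewrite [X in X @ _](_ : _ = fun i => t *: ((t_ i)^-1 *: (x_ i - x))).
    exact: cvgZl_tmp.
  by apply/funext => i; rewrite invfM invrK scalerA.
Qed.

Theorem proposition2 (R : realType) (E : euclideanType R) (C : set E)
    (C_nonempty : C !=set0) (C_closed : closed C)
    (C_derivable : forall x, C x -> geometrically_derivable C x)
    (Rt : {fun tangent_bundle C >-> C})
    (Rt_proj : forall x v, C x -> tangent_cone C x v ->
       projection C (x + v) (Rt (x, v))) :
  is_retraction Rt.
Proof.
move=> x v Cx Tv.
have [eps [eps0 [gamma [gamma0 gammav]]]] := C_derivable x Cx v Tv.
apply/cvgr0Pnorm_lt => e e0.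
move/cvgrPdist_lt : gammav => /(_ e e0); rewrite gamma0 => gamma_near.
near=> t.
have t0 : 0 < t by near: t; exact: nbhs_right_gt.
(* [gamma] is only known to take values in [C] on [[0, eps]], so [t] must also be at most [eps]. *)
have Cgamma : C (gamma t).
  apply: (@funS _ _ _ _ gamma); rewrite /= in_itv/= (ltW t0)/=.
  by near: t; exact: nbhs_right_le.
have Ttv : tangent_cone C x (t *: v) by exact: tangent_coneZ.
have [_ /(_ _ Cgamma) Rt_le] := Rt_proj x (t *: v) Cx Ttv.
(* It remains to bound the error quotient of [Rt] by that of [gamma]. *)
have : `|v - t^-1 *: (gamma t - x)| < e by near: t.
apply: le_lt_trans.
have -> : v - t^-1 *: (gamma t - x) = t^-1 *: (x + t *: v - gamma t).
  rewrite -[in LHS](scalerK (lt0r_neq0 t0) v) -scalerBr opprB.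
  by rewrite addrA (addrC (t *: v)).
(* Cancelling the common positive factor [|t^-1|] leaves exactly [Rt_le]. *)
by rewrite !normrZ distrC ler_pM2l// normr_gt0 invr_eq0 gt_eqF.
Unshelve. all: by end_near.
Qed.
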